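(* For every odd integer $n>1$ write $n-1=d\,2^{s}$ with $d$ odd, and let $W(n)$ denote the set of Miller–Rabin witnesses for $n$, i.e. the set of integers $a$ with $1<a<n$ such that (1) $\gcd(a,n)=1$, (2) $a^{d}\not\equiv 1 \pmod n$, and (3) for all integers $j$ with $0\le j<s$, $a^{d2^{j}}\not\equiv -1\pmod n$. Then, as $n\to\infty$ along odd composite numbers, the normalized witness sets $\{w/n : w\in W(n)\}$ become equidistributed in $[0,1]$: for every interval $[a,b]\subset[0,1]$, $$\frac{\#\{w\in W(n) : w/n\in[a,b]\}}{\#W(n)}\longrightarrow b-a \quad\text{as } n\to\infty \text{ through odd composite } n.$$
   Context: $\#S$ denotes the cardinality of a set $S$. *)

(* Defs.v *)
From mathcomp Require Import all_boot all_order all_algebra.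
From mathcomp Require Import all_classical all_reals all_analysis.

Set Implicit Arguments.
Unset Strict Implicit.
Unset Printing Implicit Defensive.

Import Order.TTheory GRing.Theory Num.Theory.
Import numFieldNormedType.Exports.

Local Open Scope ring_scope.

(* For n > 1, the unique decomposition n - 1 = mr_d n * 2 ^ mr_s n with mr_d n
   odd (see mr_decomposition). *)
Definition mr_s (n : nat) : nat := logn 2 n.-1.

Definition mr_d (n : nat) : nat := (n.-1 %/ 2 ^ mr_s n)%N.

Lemma mr_decomposition (n : nat) :
  (1 < n)%N -> n.-1 = (mr_d n * 2 ^ mr_s n)%N /\ odd (mr_d n).
Proof.
case: n => [|[|n]] // _; rewrite /mr_d /mr_s /=.
have [m co_m E] := pfactor_coprime (isT : prime 2) (ltn0Sn n).
rewrite divnK ?pfactor_dvdnn //; split => //.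
by rewrite [X in (X %/ _)%N]E mulnK ?expn_gt0 // -coprime2n.
Qed.

(* The congruences are taken in int, so that -1 is the actual integer -1. *)
Definition mr_witness (n a : nat) : bool :=
  [&& (1 < a < n)%N,
      coprime a n,
      (a%:Z ^+ mr_d n != 1 %[mod n%:Z])%Z
    & [forall j : 'I_(mr_s n), (a%:Z ^+ (mr_d n * 2 ^ j) != -1 %[mod n%:Z])%Z]].

Definition W (n : nat) : {set 'I_n} := [set a : 'I_n | mr_witness n a]%SET.

Definition odd_composite (n : nat) : Prop := [/\ odd n, (1 < n)%N & ~~ prime n].

(* Main.v *)
Require Import Defs.
From mathcomp Require Import all_classical all_reals all_analysis.
From mathcomp Require Import all_boot all_order all_algebra all_fingroup zify ring lra.

(** Nonwitnesses mod [n] form a disjoint union of a subgroup [x^d = 1] of the unit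
    group and at most [s] cosets [x^(d 2^j) = -1] of subgroups, with [2^s < n].  So
    it suffices that every coset [gH] has about [|H| m / n] elements in [[0, m)], up
    to an error that is a power of [n] smaller than [n], and that at least half of
    the units are witnesses.

    For the first point, [#(tH \cap [0, m))] is constant for [t] in [gH], so the
    squared error at [g] is at most [1 / |H|] times the variance over all [t] mod
    [n].  This gives the bound [\sum_(h in H) (N(h) - m^2 / n)], where [N(h)] counts
    the [t < m] with [t h mod n < m].  Dirichlet approximation [h / n ~ p / q]
    makes [t h] run through an almost uniform grid as [t] runs through [q]
    consecutive integers, hence [N(h) <= m^2 / n + O(n / q + q)]; few [h] admit a
    small denominator [q].  The total error is compared with [totient n] by means of
    [n <= totient n * 2^omega] and [B^omega <= B^B n]. *)

Set Implicit Arguments.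
Unset Strict Implicit.
Unset Printing Implicit Defensive.

Import Order.TTheory GRing.Theory Num.Theory.
Import numFieldNormedType.Exports.

(** * Growth estimates *)

Lemma prod_primes_pfactor (n : nat) : 0 < n -> \prod_(p <- primes n) p ^ logn p n = n.
Proof.
by move=> n0; rewrite [RHS]prod_prime_decomp // prime_decompE big_map.
Qed.

Lemma leq_prod_seq (T : eqType) (r : seq T) (f g : T -> nat) :
  {in r, forall i, f i <= g i} -> \prod_(i <- r) f i <= \prod_(i <- r) g i.
Proof.
move=> le_fg; rewrite big_seq [leqRHS]big_seq.
by apply: (big_ind2 leq) => // a b c d; exact: leq_mul.
Qed.

Lemma prodn_const_seq (T : Type) (r : seq T) (P : pred T) (k : nat) :
  \prod_(i <- r | P i) k = k ^ count P r.
Proof. by rewrite big_const_seq iter_muln_1. Qed.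

(** Each prime power satisfies [p ^ e <= 2 * (p - 1) * p ^ (e - 1)], because [p >= 2]. *)
Lemma leq_totient_primes (n : nat) : 0 < n -> n <= totient n * 2 ^ size (primes n).
Proof.
move=> n0; rewrite totientE // -{1}(prod_primes_pfactor n0).
rewrite -count_predT -prodn_const_seq -big_split /=.
apply: leq_prod_seq => p; rewrite mem_primes => /and3P[pp _ pn].
have := prime_gt1 pp; have : 0 < logn p n by rewrite logn_gt0 mem_primes pp n0.
case: logn => // e _ p1; rewrite expnS /= mulnAC leq_mul2r; apply/orP; right; lia.
Qed.

(** A prime [p >= B] pays for its factor [B] by its own power in [n]; the primes below [B] number at
    most [B] and account for [B ^ B]. *)
Lemma expn_size_primes_le (B n : nat) : 0 < n -> B ^ size (primes n) <= B ^ B * n.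
Proof.
case: B => [|B] n0.
  by rewrite expn0 mul1n (leq_trans _ n0) //; case: (size _) => // k; rewrite exp0n.
have le1 : count (fun p => p < B.+1) (primes n) <= B.+1.
  rewrite -size_filter -[leqRHS](size_iota 0) uniq_leq_size ?filter_uniq ?primes_uniq //.
  by move=> p; rewrite mem_filter mem_iota add0n => /andP[].
rewrite -count_predT -prodn_const_seq.
apply: (@leq_trans (\prod_(p <- primes n) ((if p < B.+1 then B.+1 else 1) * p ^ logn p n))).
  apply: leq_prod_seq => p pn; have := pn; rewrite -logn_gt0 => e0.
  move: pn; rewrite mem_primes => /and3P[pp _ _].
  have ppow : p <= p ^ logn p n by rewrite -{1}[p]expn1 leq_exp2l ?prime_gt1.
  case: (ltnP p B.+1) => [_|leBp]; last by rewrite mul1n (leq_trans leBp).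
  by rewrite leq_pmulr // (leq_trans _ ppow) // prime_gt0.
rewrite big_split /= prod_primes_pfactor // leq_mul2r -big_mkcond prodn_const_seq.
by rewrite leq_pexp2l ?orbT.
Qed.

(** Raise [s <= k.+1 * 2 ^ (s %/ k.+1).+1] to the power [k.+1]; this inequality comes from
    [x < 2 ^ x] at [x = (s %/ k.+1).+1]. *)
Lemma expnS_le_exp2 (k s : nat) : s ^ k.+1 <= k.+1 ^ k.+1 * 2 ^ k.+1 * 2 ^ s.
Proof.
have le_s : s <= k.+1 * 2 ^ (s %/ k.+1).+1.
  rewrite (leq_trans (ltnW (ltn_ceil s (ltn0Sn k)))) // mulnC leq_mul2l.
  by rewrite (ltnW (ltn_expl _ _)) ?orbT.
apply: (@leq_trans ((k.+1 * 2 ^ (s %/ k.+1).+1) ^ k.+1)); first by rewrite leq_exp2r.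
rewrite expnMn -mulnA leq_mul2l -expnM -expnD leq_exp2l //.
by rewrite mulSn leq_add2l leq_divM orbT.
Qed.

Lemma mul_poly_log_le (c k : nat) : exists N, forall n s : nat,
  N <= n -> 2 ^ s <= n -> c * s.+2 ^ k <= n.
Proof.
pose C := 4 * (k.+1 ^ k.+1 * 2 ^ k.+1).
have leC s : s.+2 ^ k.+1 <= C * 2 ^ s.
  rewrite (leq_trans (expnS_le_exp2 k s.+2)) // /C (expnS 2 s.+1) (expnS 2 s).
  by move: (_ * 2 ^ k.+1) (2 ^ s) => A x; lia.
(* The bound [leC] has exponent [k.+1], one more than the goal: for [s.+2 > c * C] the extra factor
   absorbs [c * C], and for smaller [s] the left side is at most this constant. *)
exists (c * (c * C) ^ k) => n s n_ge s_le.
have [le_s|lt_s] := leqP s.+2 (c * C).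
  rewrite (leq_trans _ n_ge) // leq_mul2l.
  by case: (k) => [|j]; rewrite ?expn0 ?leq_exp2r ?le_s ?orbT.
rewrite (leq_trans _ s_le) //.
have C0 : 0 < C by rewrite !muln_gt0 !expn_gt0.
rewrite -(leq_pmul2l C0) (leq_trans _ (leC s)) // mulnA [C * c]mulnC expnS.
by rewrite leq_mul2r (ltnW lt_s) orbT.
Qed.

(** Provides [K ^ 4 <= n] for the [K] chosen in [W_discrepancy]. *)
Lemma mul_poly_log_exp_primes_le (c : nat) : exists N, forall n s : nat,
  N <= n -> 2 ^ s <= n -> (c * (s.+2 * 2 ^ size (primes n)) ^ 2) ^ 4 <= n.
Proof.
have [D le_D] : exists D, forall n, 0 < n -> (2 ^ 16) ^ size (primes n) <= D * n.
  by eexists => n; exact: expn_size_primes_le.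
have [N le_N] := mul_poly_log_le (c ^ 8 * D) 16.
exists (maxn 1 N) => n s; rewrite geq_max => /andP[n0 n_ge] s_le.
(* After squaring, one factor [n] on the right bounds [c ^ 8 * D * s.+2 ^ 16], and the other bounds
   [(2 ^ 16) ^ size (primes n)] up to the factor [D]. *)
rewrite -(@leq_exp2r _ _ 2) //.
apply: leq_trans (leq_mul (le_N _ _ n_ge s_le) (leqnn n)).
have -> : ((c * (s.+2 * 2 ^ size (primes n)) ^ 2) ^ 4) ^ 2 =
    c ^ 8 * s.+2 ^ 16 * (2 ^ 16) ^ size (primes n).
  have -> : (2 ^ 16) ^ size (primes n) = (2 ^ size (primes n)) ^ 16 by rewrite -!expnM mulnC.
  by move: (2 ^ size _) (s.+2) => y x; ring.
rewrite -mulnA [c ^ 8 * D * _]mulnAC -!mulnA !leq_mul2l le_D ?orbT //.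
Qed.

(** * Multiples of a residue in an interval *)

Lemma card_le_in_inj (T : finType) (A : {set T}) (f : T -> nat) (M : nat) :
  {in A &, injective f} -> {in A, forall x, f x < M} -> #|A| <= M.
Proof.
move=> f_inj f_lt; case: M f_lt => [|M] f_lt.
  by rewrite leqn0 cards_eq0; apply/eqP/setP => x; rewrite in_set0; apply/idP => /f_lt.
rewrite -[M.+1]card_ord -(@card_in_imset _ _ (fun x => inord (f x) : 'I_M.+1)) ?max_card //.
move=> x y Ax Ay /(congr1 val) /=; rewrite !inordK ?f_lt //; exact: f_inj.
Qed.

(* [|q h - p n| <= R], written without truncated subtraction. *)
Definition rat_approx (n h R q p : nat) : bool :=
  [&& 0 < q, coprime p q, q * h <= p * n + R & p * n <= q * h + R].

Lemma same_box_dist (n Q y1 y2 : nat) : 0 < n -> 0 < Q ->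
  Q * y1 %/ n = Q * y2 %/ n -> y1 <= y2 + n %/ Q.
Proof.
move=> n0 Q0 eq12; rewrite -leq_subLR leq_divRL // mulnC mulnBr leq_subLR.
rewrite (leq_trans (ltnW (ltn_ceil (Q * y1) n0))) // mulSnr eq12 leq_add2r.
exact: leq_divM.
Qed.

Lemma leq_mul_reduce (g q p h n R : nat) : 0 < g ->
  g * q * h <= g * p * n + R -> q * h <= p * n + R.
Proof.
move=> g0 le_gq; rewrite -(leq_pmul2l g0) mulnDr !mulnA (leq_trans le_gq) //.
by rewrite leq_add2l leq_pmull.
Qed.

(** Pigeonhole: two of the [Q.+1] residues [j h mod n] share one of [Q] boxes of length [n / Q], and
    the difference of their indices serves as denominator. *)
Lemma dirichlet_approx (n h Q : nat) : 0 < n -> 0 < Q ->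
  exists q p, (q <= Q) && rat_approx n h (n %/ Q) q p.
Proof.
move=> n0 Q0.
have add_cross (a b c d e f x y : nat) :
  a + c = d -> b + e = f -> c = e + x -> d = f + y -> a + x = b + y by lia.
pose box (j : 'I_Q.+1) : nat := (Q * (j * h %% n)) %/ n.
have box_lt j : box j < Q by rewrite ltn_divLR // ltn_pmul2l // ltn_pmod.
have /existsP[j1 /existsP[j2 /andP[lt12 /eqP eq12]]] :
    [exists j1 : 'I_Q.+1, exists j2 : 'I_Q.+1, (j1 < j2) && (box j1 == box j2)].
  apply: contraT => /existsPn noc.
  have: #|[set: 'I_Q.+1]| <= Q.
    apply: (@card_le_in_inj _ _ box) => // x y _ _ eqb.
    have := noc x => /existsPn /(_ y); have := noc y => /existsPn /(_ x).
    rewrite eqb eqxx !andbT -!leqNgt => le1 le2.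
    by apply/val_inj/eqP; rewrite /= eqn_leq le1 le2.
  by rewrite cardsT card_ord ltnn.
set y1 := j1 * h %% n; set y2 := j2 * h %% n.
have e1 : j1 * h = (j1 * h %/ n) * n + y1 by exact: divn_eq.
have e2 : j2 * h = (j2 * h %/ n) * n + y2 by exact: divn_eq.
have le_div : j1 * h %/ n <= j2 * h %/ n by rewrite leq_div2r // leq_mul2r (ltnW lt12) orbT.
have y12 : y1 <= y2 + n %/ Q by exact: same_box_dist.
have y21 : y2 <= y1 + n %/ Q by exact: same_box_dist.
pose q := j2 - j1; pose p := j2 * h %/ n - j1 * h %/ n.
have q0 : 0 < q by rewrite subn_gt0.
have g0 : 0 < gcdn p q by rewrite gcdn_gt0 q0 orbT.
have ep : p = gcdn p q * (p %/ gcdn p q) by rewrite mulnC divnK ?dvdn_gcdl.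
have eq : q = gcdn p q * (q %/ gcdn p q) by rewrite mulnC divnK ?dvdn_gcdr.
have qQ : q <= Q by rewrite leq_subLR (leq_trans (leq_ord j2)) ?leq_addl.
have qh : q * h + y1 = p * n + y2.
  apply: add_cross e1 e2; first by rewrite -mulnDl subnK // ltnW.
  by rewrite -mulnDl subnK.
(* Dividing by the gcd gives coprimality and keeps the error bound, by [leq_mul_reduce]. *)
exists (q %/ gcdn p q), (p %/ gcdn p q).
have qg0 : 0 < q %/ gcdn p q by rewrite divn_gt0 // dvdn_leq ?dvdn_gcdr.
rewrite (leq_trans (leq_div _ _) qQ) /rat_approx qg0 /=.
apply/and3P; split.
- by rewrite /coprime -(eqn_pmul2l g0) muln_gcdr -ep -eq muln1.
- by apply: (leq_mul_reduce g0); rewrite -ep -eq -(leq_add2r y1) qh -addnA leq_add2l [leqRHS]addnC.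
- by apply: (leq_mul_reduce g0); rewrite -ep -eq -(leq_add2r y2) -qh -addnA leq_add2l [leqRHS]addnC.
Qed.

(* [q ((c + i h) mod n)] is [n k_i] up to a bounded multiple of [n], where the
   integers [k_i = e + i p - q z_i] are distinct mod [q] since [p] and [q] are coprime. *)
Lemma card_block_le (n h R q p c L : nat) :
  0 < n -> rat_approx n h R q p -> q * R <= n ->
  #|[set i : 'I_q | (c + i * h) %% n < L]| <= (q * L) %/ n + 3.
Proof.
move=> n0 /and4P[q0 co_pq le1 le2] qR.
pose z (i : 'I_q) : nat := (c + i * h) %/ n.
pose e := (q * c) %/ n; pose f := (q * c) %% n.
have lf : f < n by exact: ltn_pmod.
have eqc : q * c = e * n + f by exact: divn_eq.
(* A residue below [L] forces [-1 <= k_i <= q L / n + 1]; the shift by one keeps [k_i] in [nat] and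
   leaves [q L / n + 3] values. *)
have key (i : 'I_q) : (c + i * h) %% n < L ->
    q * z i <= (e + i * p).+1 /\ (e + i * p).+1 - q * z i <= (q * L) %/ n + 2.
  move=> ltL; have ez : c + i * h = z i * n + (c + i * h) %% n by exact: divn_eq.
  move: ltL ez; set y := (_ %% _) => ltL ez.
  have iR : i * R <= n by rewrite (leq_trans _ qR) // leq_mul2r ltnW ?orbT.
  have E1 : q * z i * n + q * y = e * n + f + i * (q * h).
    by rewrite -eqc -mulnA -mulnDr -ez mulnDr; lia.
  have I1 : i * (q * h) <= i * p * n + n.
    by rewrite (leq_trans (leq_mul (leqnn i) le1)) // mulnDr mulnA leq_add2l.
  have I2 : i * p * n <= i * (q * h) + n.
    by rewrite -mulnA (leq_trans (leq_mul (leqnn i) le2)) // mulnDr leq_add2l.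
  have qy : q * y <= q * L by rewrite leq_mul2l (ltnW ltL) orbT.
  split.
    rewrite -ltnS -(ltn_pmul2r n0) !mulSn mulnDl; lia.
  have : (e + i * p - q * z i).-1 <= (q * L) %/ n.
    rewrite leq_divRL // -subn1 !mulnBl mulnDl; lia.
  lia.
apply: (@card_le_in_inj _ _ (fun i : 'I_q => (e + i * p).+1 - q * z i)) => [i j|i]; rewrite !inE.
  move=> /key[i1 _] /key[j1 _] eqij.
  have e_ij : i * p + q * z j = j * p + q * z i by lia.
  have inj_le (a b : 'I_q) : a <= b -> a * p + q * z b = b * p + q * z a -> a = b.
    move=> leab eab; have : q %| (b - a) * p.
      rewrite mulnBl -(subnDr (q * z b)) eab [b * p + _]addnC [b * p + _]addnC.
      by rewrite subnDr dvdn_sub ?dvdn_mulr.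
    rewrite Gauss_dvdl 1?coprime_sym // => /dvdnP[[|k] e_ba].
      by apply/val_inj/eqP; rewrite /= eqn_leq leab -subn_eq0 e_ba.
    have := ltn_ord b; have : b - a <= b by exact: leq_subr.
    rewrite e_ba; nia.
  by case: (leqP i j) => [/inj_le|/ltnW/inj_le inj_ji]; [apply|rewrite inj_ji].
by move=> /key[_]; lia.
Qed.

Lemma sum_nat_blocks (F : nat -> nat) (k q : nat) :
  \sum_(0 <= t < k * q) F t = \sum_(j < k) \sum_(i < q) F (j * q + i).
Proof.
elim: k => [|k IH]; first by rewrite mul0n big_geq // big_ord0.
rewrite big_ord_recr /= -IH mulSn addnC (big_cat_nat (n := k * q)) ?leq_addr //=.
congr (_ + _); rewrite -{1}[k * q]add0n big_addn addKn big_mkord.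
by apply: eq_bigr => i _; rewrite addnC.
Qed.

(** The range [[0, m)] is covered by [m %/ q + 1] blocks of [q] consecutive integers, each bounded
    by [card_block_le]. *)
Lemma overlap_le_nat (n h R q p m : nat) :
  0 < n -> rat_approx n h R q p -> q * R <= n ->
  \sum_(0 <= t < m) ((t * h) %% n < m) <= (m %/ q).+1 * ((q * m) %/ n + 3).
Proof.
move=> n0 apx qR; have q0 : 0 < q by case/and4P: apx.
have le_m : m <= (m %/ q).+1 * q by rewrite ltnW // ltn_ceil.
apply: (@leq_trans (\sum_(0 <= t < (m %/ q).+1 * q) ((t * h) %% n < m))).
  by rewrite [leqRHS](big_cat_nat (n := m)) //= leq_addr.
rewrite sum_nat_blocks -[X in _ <= X * _]card_ord -sum_nat_const.
apply: leq_sum => j _; apply: leq_trans (card_block_le (j * q * h) m n0 apx qR).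
rewrite -sum1_card [leqRHS]big_mkcond /=; apply: leq_sum => i _.
by rewrite inE mulnDl; case: ltnP.
Qed.

Local Open Scope ring_scope.

Lemma ler_nat_divn (F : realFieldType) (a b : nat) : (a %/ b)%:R <= a%:R / b%:R :> F.
Proof.
case: b => [|b]; first by rewrite divn0 invr0 mulr0.
by rewrite ler_pdivlMr ?ltr0Sn // -natrM ler_nat leq_divM.
Qed.

Lemma overlap_le (F : realFieldType) (n h R q p m : nat) :
  (0 < n)%N -> (m <= n)%N -> rat_approx n h R q p -> (q * R <= n)%N ->
  (\sum_(0 <= t < m) ((t * h) %% n < m))%N%:R
    <= m%:R ^+ 2 / n%:R + (3 * n%:R / q%:R + q%:R + 3) :> F.
Proof.
move=> n0 lemn apx qR; have q0 : (0 < q)%N by case/and4P: apx.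
have n0' : 0 < n%:R :> F by rewrite ltr0n.
have q0' : 0 < q%:R :> F by rewrite ltr0n.
have lemn' : m%:R <= n%:R :> F by rewrite ler_nat.
have m0 : 0 <= m%:R :> F by rewrite ler0n.
apply: (@le_trans _ _ ((m%:R / q%:R + 1) * ((q%:R * m%:R) / n%:R + 3))).
  apply: le_trans (_ : ((m %/ q).+1 * ((q * m) %/ n + 3))%N%:R <= _).
    by rewrite ler_nat; exact: overlap_le_nat apx qR.
  rewrite natrM -natr1 natrD ler_pM ?lerD ?addr_ge0 ?ler01 ?ler0n //; first exact: ler_nat_divn.
  by rewrite -natrM ler_nat_divn.
have -> : (m%:R / q%:R + 1) * (q%:R * m%:R / n%:R + 3) =
   m%:R ^+ 2 / n%:R + (3 * m%:R / q%:R + q%:R * (m%:R / n%:R) + 3) :> F.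
  by field; rewrite !pnatr_eq0 -!lt0n n0 q0.
rewrite lerD2l lerD2r lerD //.
  by rewrite ler_pM2r ?invr_gt0 // ler_pM2l // ltr0n.
by rewrite ler_piMr ?ler0n // ler_pdivrMr // mul1r.
Qed.

(** The exceptional multipliers: for [q < K] the error [n / q] in the overlap bound is too large.
    Bounding [p] as well lets them be counted by triples. *)
Definition low_denominator (n R K h : nat) : bool :=
  [exists q : 'I_K, exists p : 'I_K, rat_approx n h R q p].

(** The triple of [q], [p] and the offset [q h + R - p n], which lies in [[0, 2 R]], determines
    [h]. *)
Lemma card_low_denominator (n R K : nat) :
  (#|[set h : 'I_n | low_denominator n R K h]| <= K * K * (2 * R).+1)%N.
Proof.
case: n => [|n]; first by rewrite (leq_trans (max_card _)) ?card_ord.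
pose f (x : 'I_K * 'I_K * 'I_(2 * R).+1) : 'I_n.+1 :=
  inord ((x.1.2 * n.+1 + x.2 - R) %/ x.1.1).
have -> : (K * K * (2 * R).+1 = #|{: 'I_K * 'I_K * 'I_(2 * R).+1}|)%N.
  by rewrite !card_prod !card_ord.
apply: leq_trans (leq_imset_card f _); apply/subset_leq_card/fintype.subsetP => h.
rewrite inE => /existsP[q /existsP[p /and4P[q0 _ le1 le2]]].
have lt_r : (q * h + R - p * n.+1 < (2 * R).+1)%N by lia.
apply/imsetP; exists (q, p, Ordinal lt_r) => //; apply/val_inj; rewrite /f /=.
have -> : (p * n.+1 + (q * h + R - p * n.+1) - R = q * h)%N by lia.
by rewrite mulKn // inordK.
Qed.

(** Dirichlet approximation with [Q = K ^ 3]: a denominator in [[K, K ^ 3]] gives the first three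
    terms; otherwise [h] is exceptional and the trivial bound [n] applies. *)
Lemma overlap_excess (F : realFieldType) (n h K m : nat) :
  (0 < K)%N -> (K ^ 4 <= n)%N -> (h < n)%N -> (m <= n)%N ->
  (\sum_(0 <= t < m) ((t * h) %% n < m))%N%:R - m%:R ^+ 2 / n%:R
    <= 3 * n%:R / K%:R + K%:R ^+ 3 + 3
       + n%:R * (low_denominator n (n %/ K ^ 3) K h)%:R :> F.
Proof.
move=> K0 K4 hn mn; have n0 : (0 < n)%N by exact: leq_ltn_trans hn.
have K3 : (0 < K ^ 3)%N by rewrite expn_gt0 K0.
have [q [p /andP[qQ apx]]] := dirichlet_approx h n0 K3.
have [Kq|qK] := leqP K q.
  have qR : (q * (n %/ K ^ 3) <= n)%N.
    by rewrite (leq_trans _ (leq_divM n (K ^ 3))) // mulnC leq_mul2l qQ orbT.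
  have := overlap_le F n0 mn apx qR; rewrite -lerBlDl => /le_trans; apply.
  rewrite -[leLHS]addr0 lerD ?mulr_ge0 ?ler0n // lerD // lerD //.
    rewrite ler_wpM2l ?mulr_ge0 ?ler0n // lef_pV2 ?posrE ?ltr0n ?ler_nat //.
    exact: leq_trans Kq.
  by rewrite -natrX ler_nat.
have -> : low_denominator n (n %/ K ^ 3) K h.
  have pK : (p < K)%N.
    case/and4P: (apx) => q0 _ _; have := leq_div n (K ^ 3); nia.
  by apply/existsP; exists (Ordinal qK); apply/existsP; exists (Ordinal pK).
have le1 : (\sum_(0 <= t < m) ((t * h) %% n < m))%N%:R <= n%:R :> F.
  rewrite ler_nat (leq_trans _ mn) // -[leqRHS]subn0 -[leqRHS]muln1 -sum_nat_const_nat.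
  by apply: leq_sum => t _; case: ltnP.
have ge1 : 0 <= m%:R ^+ 2 / n%:R :> F by rewrite divr_ge0 ?exprn_ge0 ?ler0n.
have ge2 : 0 <= 3 * n%:R / K%:R + K%:R ^+ 3 + 3 :> F.
  by rewrite !addr_ge0 ?divr_ge0 ?mulr_ge0 ?exprn_ge0 ?ler0n.
by rewrite mulr1; lra.
Qed.

(** * Cosets of subgroups of the units in an interval *)

Section Variance.
Variables (F : realFieldType) (T : finComUnitRingType).
Variables (H : {group {unit T}}) (g : {unit T}) (S : {set T}).

Let N (h : {unit T}) : F := #|[set t in S | t * val h \in S]|%:R.
Let f (t : T) : F := \sum_(h in H) (t * val h \in S)%:R.

Let natr_card (A : {set T}) : #|A|%:R = \sum_(t : T) (t \in A)%:R :> F.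
Proof. by rewrite -sum1_card natr_sum big_mkcond; apply: eq_bigr => t _; case: ifP. Qed.

Let mulr_val_inj (h : {unit T}) : injective (fun t : T => t * val h).
Proof. by move=> x y; apply: (mulIr (valP h)). Qed.

Let sum_f : \sum_(t : T) f t = #|H|%:R * #|S|%:R.
Proof.
rewrite exchange_big /= mulr_natl -sumr_const; apply: eq_bigr => h _.
by rewrite natr_card [RHS](reindex_inj (@mulr_val_inj h)).
Qed.

(** Expanding the square counts triples [t, h, l] with [t h] and [t l] in [S]; substituting
    [l = h k] and then [t] for [t h] reduces the count to [N k], whatever [h] is. *)
Let sum_f2 : \sum_(t : T) f t ^+ 2 = #|H|%:R * \sum_(h in H) N h.
Proof.
under eq_bigr do rewrite expr2 mulr_suml.
rewrite exchange_big /= mulr_natl -sumr_const; apply: eq_bigr => h hH.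
under eq_bigr do rewrite mulr_sumr.
rewrite exchange_big /= (reindex_inj (mulgI h)) /=.
apply: eq_big => [k|k kH]; first by rewrite groupMl.
rewrite /N natr_card [RHS](reindex_inj (@mulr_val_inj h)) /=; apply: eq_bigr => t _.
by rewrite inE /= mulrA; case: (t * _ \in S); rewrite ?mul1r ?mul0r.
Qed.

Lemma coset_discrepancy_le :
  (\sum_(h in H) (val (g * h)%g \in S)%:R - #|H|%:R * #|S|%:R / #|T|%:R) ^+ 2
    <= \sum_(h in H) (N h - #|S|%:R ^+ 2 / #|T|%:R).
Proof.
set mu := _ / _; have T0 : 0 < #|T|%:R :> F by rewrite ltr0n; apply/card_gt0P; exists 0.
have H0 : 0 < #|H|%:R :> F by rewrite ltr0n cardG_gt0.
have f_coset k : k \in H -> f (val (g * k)%g) = f (val g).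
  move=> kH; rewrite /f [RHS](reindex_inj (mulgI k)) /=.
  by apply: eq_big => [h|h _]; rewrite ?groupMl // mulrA.
have -> : \sum_(h in H) (val (g * h)%g \in S)%:R = f (val g) by [].
(* As [f] is constant on [g H], multiplying by [#|H|] turns the squared error into a sum over that
   coset, which is part of the sum over all [t]. *)
rewrite -(ler_pM2l H0).
have -> : #|H|%:R * (f (val g) - mu) ^+ 2 = \sum_(k in H) (f (val (g * k)%g) - mu) ^+ 2.
  by rewrite mulr_natl -sumr_const; apply: eq_bigr => k /f_coset ->.
have val_g_inj : {in H &, injective (fun k => val (g * k)%g)}.
  by move=> k l _ _ /val_inj /mulgI.
rewrite -(big_imset (fun t => (f t - mu) ^+ 2) val_g_inj) /=.
apply: (@le_trans _ _ (\sum_(t : T) (f t - mu) ^+ 2)).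
  rewrite [leRHS](bigID (mem [set val (g * k)%g | k in H])) /= lerDl.
  by rewrite sumr_ge0 // => t _; exact: sqr_ge0.
have -> : \sum_(t : T) (f t - mu) ^+ 2 =
    \sum_(t : T) f t ^+ 2 - (mu *+ 2) * \sum_(t : T) f t + #|T|%:R * mu ^+ 2.
  have -> : #|T|%:R * mu ^+ 2 = \sum_(t : T) mu ^+ 2 by rewrite sumr_const mulr_natl.
  by rewrite mulr_sumr -sumrB -big_split /=; apply: eq_bigr => t _; ring.
rewrite sum_f sum_f2 sumrB sumr_const -[(_ / _) *+ _]mulr_natl mulrBr.
rewrite -addrA lerD2l /mu le_eqVlt; apply/orP; left; apply/eqP; field.
by rewrite gt_eqF.
Qed.
End Variance.

Lemma sum_ord_lt (V : nmodType) (n m : nat) (f : nat -> V) : (m <= n)%N ->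
  \sum_(i < n | (i < m)%N) f i = \sum_(0 <= t < m) f t.
Proof. by move=> le_mn; rewrite big_mkord [RHS](big_ord_widen _ _ le_mn). Qed.

Lemma coset_interval_discrepancy (F : realFieldType) (n m K : nat)
    (H : {group {unit 'Z_n}}) (g : {unit 'Z_n}) :
  (1 < n)%N -> (m <= n)%N -> (0 < K)%N -> (K ^ 4 <= n)%N ->
  (\sum_(h in H) ((val (g * h)%g < m)%N%:R - m%:R / n%:R)) ^+ 2
    <= 10 * n%:R ^+ 2 / K%:R :> F.
Proof.
(* For [n] of the form [n'.+2], the type ['Z_n] reduces to ['I_n]. *)
case: n H g => [|[|n']] // H g _; set n := n'.+2 => mn K0 K4.
have cardZ : #|'Z_n| = n by rewrite card_ord.
pose S : {set 'Z_n} := [set t : 'Z_n | (t < m)%N].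
have cardS : #|S| = m.
  rewrite -sum1_card (eq_bigl (fun i : 'I_n => (i < m)%N)); last by move=> i; rewrite inE.
  by rewrite (sum_ord_lt (fun=> 1%N)) // sum_nat_const_nat subn0 muln1.
have overlapE (h : {unit 'Z_n}) :
    #|[set t in S | t * val h \in S]| = (\sum_(0 <= t < m) ((t * val h) %% n < m))%N.
  rewrite -(sum_ord_lt (fun t => ((t * val h) %% n < m)%N : nat) mn) -sum1_card.
  rewrite big_mkcond [RHS]big_mkcond; apply: eq_bigr => t _; rewrite !inE /=.
  by case: (t < m)%N => //=; case: ifP.
have -> : \sum_(h in H) ((val (g * h)%g < m)%N%:R - m%:R / n%:R) =
    \sum_(h in H) (val (g * h)%g \in S)%:R - #|H|%:R * #|S|%:R / #|'Z_n|%:R :> F.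
  rewrite sumrB sumr_const -[(_ / _) *+ _]mulr_natl mulrA cardS cardZ; congr (_ - _).
  by apply: eq_bigr => h _; rewrite inE.
apply: le_trans (coset_discrepancy_le _ _ _ _) _; rewrite cardS cardZ.
pose A : F := 3 * n%:R / K%:R + K%:R ^+ 3 + 3.
pose R := (n %/ K ^ 3)%N.
have K0' : 0 < K%:R :> F by rewrite ltr0n.
apply: (@le_trans _ _ (\sum_(h in H) (A + n%:R * (low_denominator n R K (val h))%:R))).
  by apply: ler_sum => h _; rewrite overlapE; exact: overlap_excess.
rewrite big_split /= sumr_const -[A *+ _]mulr_natl -mulr_sumr.
have leH : #|H|%:R <= n%:R :> F.
  rewrite ler_nat -cardZ -(card_imset _ (@val_inj _ _ {unit 'Z_n})).
  exact: max_card.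
have lelow : \sum_(h in H) (low_denominator n R K (val h))%:R
     <= (K%:R ^+ 2 * (2 * (n%:R / K%:R ^+ 3) + 1) : F).
  apply: (@le_trans _ _ (K * K * (2 * R).+1)%N%:R); last first.
    rewrite !natrM -expr2 ler_pM2l ?exprn_gt0 // -natr1 lerD2r natrM ler_pM2l ?ltr0n //.
    by rewrite -natrX ler_nat_divn.
  rewrite -natr_sum ler_nat (leq_trans _ (card_low_denominator n R K)) //.
  rewrite -sum1_card [leqRHS]big_mkcond /=.
  rewrite -(big_imset (fun t : 'Z_n => (low_denominator n R K t : nat))
    (in2W (@val_inj _ _ {unit 'Z_n}))) /=.
  rewrite [leqLHS]big_mkcond; apply: leq_sum => t _; rewrite inE.
  by case: ifP => // _; case: low_denominator.
have A0 : 0 <= A by rewrite !addr_ge0 ?divr_ge0 ?mulr_ge0 ?exprn_ge0 ?ler0n.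
apply: (@le_trans _ _ (n%:R * A + n%:R * (K%:R ^+ 2 * (2 * (n%:R / K%:R ^+ 3) + 1)))).
  by apply: lerD; [exact: ler_wpM2r|apply: ler_wpM2l; rewrite ?ler0n].
have K1 : 1 <= K%:R :> F by rewrite ler1n.
(* The constant is [10 = 3 + 1 + 3 + 2 + 1], as [K ^ 4 <= n] makes each of [K ^ 3], [K ^ 2] and [1]
   at most [x]. *)
pose x : F := n%:R / K%:R.
have -> : 10 * n%:R ^+ 2 / K%:R = n%:R * (10 * x) by rewrite /x; ring.
rewrite -mulrDr ler_wpM2l ?ler0n //.
have -> : K%:R ^+ 2 * (2 * (n%:R / K%:R ^+ 3) + 1) = 2 * x + K%:R ^+ 2.
  by rewrite /x; field; rewrite gt_eqF.
have le3 : K%:R ^+ 3 <= x by rewrite ler_pdivlMr // -exprSr -natrX ler_nat.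
have le2 : K%:R ^+ 2 <= K%:R ^+ 3 :> F by rewrite ler_weXn2l.
have le1 : 1 <= K%:R ^+ 2 :> F by rewrite exprn_ege1.
rewrite /A -mulrA -/x; lra.
Qed.

(** * Witnesses among the units *)

Lemma eqr_natZp (n a b : nat) : (1 < n)%N ->
  (a%:R == b%:R :> 'Z_n) = (a == b %[mod n])%N.
Proof. by move=> n1; rewrite -val_eqE /= !val_Zp_nat. Qed.

Lemma natZp_eqN1 (n a : nat) : (1 < n)%N -> (a%:R == -1 :> 'Z_n) = (n %| a.+1)%N.
Proof. by move=> n1; rewrite -addr_eq0 natr1 -[0]/(0%:R) eqr_natZp // mod0n. Qed.

Lemma unit_power_group (T : finComUnitRingType) (E : nat) :
  exists H : {group {unit T}}, H =i [pred x | val x ^+ E == 1].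
Proof.
have gH : group_set [set x : {unit T} | val x ^+ E == 1].
  apply/group_setP; split=> [|x y]; rewrite !inE /= ?expr1n // => /eqP xE /eqP yE.
  by rewrite exprMn xE yE mulr1.
by exists (Group gH) => x; rewrite inE.
Qed.

Lemma unit_power_pm1_group (T : finComUnitRingType) (E : nat) :
  exists H : {group {unit T}}, H =i [pred x | (val x ^+ E == 1) || (val x ^+ E == -1)].
Proof.
have gH : group_set [set x : {unit T} | (val x ^+ E == 1) || (val x ^+ E == -1)].
  apply/group_setP; split=> [|x y]; rewrite !inE /= ?expr1n ?eqxx // => xE yE.
  rewrite exprMn; case/orP: xE => /eqP ->; case/orP: yE => /eqP ->.
  - by rewrite mulr1 eqxx.
  - by rewrite mul1r eqxx orbT.
  - by rewrite mulr1 eqxx orbT.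
  - by rewrite mulrNN mulr1 eqxx.
by exists (Group gH) => x; rewrite inE.
Qed.

(** Otherwise [k] would divide both [a - 1] and [a + 1], hence [2]. *)
Lemma odd_dvdn_sum1F (k a : nat) : odd k -> (1 < k)%N -> a = 1 %[mod k] -> ~~ (k %| a.+1)%N.
Proof.
move=> odd_k k1 a1; apply/negP => dv.
have : (k %| 2)%N by rewrite /dvdn -[2%N]/(1 + 1)%N -modnDml -a1 modnDml addn1.
by move/(dvdn_leq (isT : (0 < 2)%N)); case: k odd_k k1 {a1 dv} => [|[|[|k]]].
Qed.

Lemma exp1D_sqr0 (T : pzRingType) (z : T) (k : nat) : z * z = 0 -> (1 + z) ^+ k = 1 + z *+ k.
Proof.
move=> z2; elim: k => [|k IH]; first by rewrite expr0 mulr0n addr0.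
by rewrite exprS IH mulrDl mul1r mulrDr mulr1 mulrnAr z2 mul0rn addr0 mulrSr addrA.
Qed.

(** The Chinese remainder theorem gives [w] equal to [v] mod [n1] and to [1] mod [n2]; then [w ^ E]
    is [-1] mod [n1] and [1] mod [n2], so neither sign holds mod [n1 * n2]. *)
Lemma power_pm1_proper_crt (n1 n2 E : nat) (v : {unit 'Z_(n1 * n2)}) :
  odd n1 -> odd n2 -> (1 < n1)%N -> (1 < n2)%N -> coprime n1 n2 -> val v ^+ E = -1 ->
  exists w : {unit 'Z_(n1 * n2)}, ~~ ((val w ^+ E == 1) || (val w ^+ E == -1)).
Proof.
move=> o1 o2 g1 g2 co vE; set n := (n1 * n2)%N in v vE *.
have n_gt1 : (1 < n)%N by rewrite (leq_trans g1) // leq_pmulr // ltnW.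
pose w0 := chinese n1 n2 (val v) 1.
have w1 : w0 = val v %[mod n1] by exact: chinese_modl.
have w2 : w0 = 1 %[mod n2] by exact: chinese_modr.
have cov : coprime n (val v).
  by rewrite -unitZpE // natr_Zp; exact: valP.
have cow : coprime n w0.
  rewrite coprimeMl; apply/andP; split.
    by rewrite -coprime_modr w1 coprime_modr; move: cov; rewrite coprimeMl => /andP[].
  by rewrite -coprime_modr w2 coprime_modr coprimen1.
have w0u : (w0%:R : 'Z_n) \is a GRing.unit by rewrite unitZpE.
exists (FinRing.unit 'Z_n w0u); rewrite /= -natrX.
have dvv : (n %| (val v ^ E).+1)%N by rewrite -natZp_eqN1 // natrX natr_Zp vE.
have w1E : w0 ^ E = val v ^ E %[mod n1] by rewrite -modnXm w1 modnXm.
have w2E : w0 ^ E = 1 %[mod n2] by rewrite -modnXm w2 modnXm exp1n.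
rewrite negb_or natZp_eqN1 // -[1]/(1%:R) eqr_natZp //; apply/andP; split.
  apply/eqP => wE.
  have wE1 : val v ^ E = 1 %[mod n1].
    by rewrite -w1E -(modn_dvdm _ (dvdn_mulr n2 (dvdnn n1))) wE modn_dvdm ?dvdn_mulr.
  have := odd_dvdn_sum1F o1 g1 wE1.
  by rewrite (dvdn_trans _ dvv) // dvdn_mulr.
have := odd_dvdn_sum1F o2 g2 w2E; apply: contra => dvw.
by rewrite (dvdn_trans _ dvw) // dvdn_mull.
Qed.

(** Take [w = 1 + z] with [z = p ^ (e - 1)], so that [z ^ 2 = 0]. Then [w ^ (2 E) = 1 + 2 E z]
    differs from [1], since [p] is odd and [E] divides [p ^ e - 1]; passing to [2 E] excludes both
    signs at once. *)
Lemma power_pm1_proper_primepow (p e E : nat) :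
  prime p -> odd p -> (1 < e)%N -> (E %| (p ^ e).-1)%N ->
  exists w : {unit 'Z_(p ^ e)}, ~~ ((val w ^+ E == 1) || (val w ^+ E == -1)).
Proof.
move=> pp op e1 dvE; set n := (p ^ e)%N.
have e0 : (0 < e)%N by exact: ltnW.
have n1 : (1 < n)%N by rewrite -(exp1n e) ltn_exp2r // prime_gt1.
pose z : 'Z_n := (p ^ e.-1)%:R.
have z2 : z * z = 0.
  rewrite -natrM -expnD; apply/eqP; rewrite -[0]/(0%:R) eqr_natZp // mod0n.
  by apply: dvdn_exp2l; lia.
have w0u : (1 + z) \is a GRing.unit.
  apply/unitrPr; exists (1 - z).
  by rewrite mulrBr mulr1 mulrDl mul1r z2 addr0 addrK.
have wE_neq1 : (1 + z) ^+ (2 * E) != 1.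
  rewrite exp1D_sqr0 // -subr_eq0 addrAC subrr add0r -mulr_natr -natrM -[0]/(0%:R).
  rewrite eqr_natZp // mod0n -/(dvdn n _) /n -{1}(prednK e0) expnSr.
  rewrite dvdn_pmul2l ?expn_gt0 ?prime_gt0 // Euclid_dvdM // negb_or; apply/andP; split.
    by rewrite dvdn_prime2 //; apply: contraL op => /eqP ->.
  apply/negP => /dvdn_trans /(_ dvE) dvp.
  have : (p %| (p ^ e).-1.+1)%N by rewrite prednK ?expn_gt0 ?prime_gt0 // dvdn_exp.
  by rewrite -addn1 dvdn_addr // dvdn1 => /eqP p_eq1; rewrite p_eq1 in pp.
exists (FinRing.unit 'Z_n w0u); rewrite /= negb_or.
apply/andP; split; apply: contra wE_neq1 => /eqP wE; rewrite mulnC exprM wE.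
  by rewrite expr1n.
by rewrite sqrrN expr1n.
Qed.

(** Split off the full power of one prime: a cofactor above [1] leads to the Chinese remainder case,
    and cofactor [1] to a prime power whose exponent exceeds [1] because [n] is not prime. *)
Lemma power_pm1_proper (n E : nat) (v : {unit 'Z_n}) :
  odd n -> (1 < n)%N -> ~~ prime n -> (E %| n.-1)%N -> val v ^+ E = -1 ->
  exists w : {unit 'Z_n}, ~~ ((val w ^+ E == 1) || (val w ^+ E == -1)).
Proof.
move=> odd_n n1 npr dvE vE; have n0 := ltnW n1.
pose p := pdiv n; have pp : prime p by exact: pdiv_prime.
have [m co_m nE] := pfactor_coprime pp n0; set e := logn p n in nE.
have e0 : (0 < e)%N by rewrite logn_gt0 mem_primes pp n0 pdiv_dvd.
have odd_p : odd p by exact: dvdn_odd (pdiv_dvd n) odd_n.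
have odd_m : odd m by apply: dvdn_odd odd_n; rewrite nE dvdn_mulr.
case: (ltngtP m 1) => [m_lt1|m1|m_eq1].
- by move: n0; rewrite nE; case: m m_lt1 {co_m nE odd_m}.
- move: v vE; rewrite nE => v vE; apply: power_pm1_proper_crt vE => //.
  + by rewrite oddX odd_p orbT.
  + by rewrite -(exp1n e) ltn_exp2r // prime_gt1.
  + by rewrite coprimeXr // coprime_sym.
move: nE; rewrite m_eq1 mul1n => nE; move: dvE npr; rewrite nE => dvE npr.
apply: power_pm1_proper_primepow => //.
by rewrite ltn_neqAle e0 andbT; apply: contraNN npr => /eqP <-.
Qed.

Definition unit_witness (n : nat) (x : {unit 'Z_n}) : bool :=
  (val x ^+ mr_d n != 1) && [forall j : 'I_(mr_s n), val x ^+ (mr_d n * 2 ^ j) != -1].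

Lemma ZpN1_neq1 (n : nat) : (2 < n)%N -> (-1 : 'Z_n) != 1.
Proof.
move=> n2; rewrite eq_sym -[X in X != _]/(1%:R) natZp_eqN1 ?(ltnW n2) //.
by apply/negP => /(dvdn_leq (isT : (0 < 2)%N)); rewrite leqNgt n2.
Qed.

Lemma eqz_mod1_natZp (n a : nat) :
  (1 < n)%N -> (a%:Z == 1 %[mod n%:Z])%Z = (a%:R == 1 :> 'Z_n).
Proof. by move=> n1; rewrite -[1 in RHS]/(1%:R) eqr_natZp // !modz_nat. Qed.

Lemma eqz_modN1_natZp (n a : nat) :
  (1 < n)%N -> (a%:Z == -1 %[mod n%:Z])%Z = (a%:R == -1 :> 'Z_n).
Proof. by move=> n1; rewrite natZp_eqN1 // eqz_mod_dvd opprK -addn1. Qed.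

Lemma mr_witness_unit (n : nat) (x : {unit 'Z_n}) : (1 < n)%N ->
  mr_witness n (val x) = unit_witness x.
Proof.
move=> n1; rewrite /mr_witness /unit_witness.
have co_x : coprime (val x) n by rewrite coprime_sym -unitZpE // natr_Zp; exact: valP.
have expE k : (val x : nat)%:Z ^+ k = (val x ^ k)%N%:Z by rewrite -!natz natrX.
rewrite co_x expE eqz_mod1_natZp // natrX natr_Zp.
have -> : [forall j : 'I_(mr_s n), (val x : nat)%:Z ^+ (mr_d n * 2 ^ j) != -1 %[mod n%:Z]]%Z =
    [forall j : 'I_(mr_s n), val x ^+ (mr_d n * 2 ^ j) != -1].
  by apply: eq_forallb => j; rewrite expE eqz_modN1_natZp // natrX natr_Zp.
have lt_xn : (val x < n)%N by have := ltn_ord (val x); rewrite [X in (_ < X)%N]Zp_cast.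
(* What remains is [val x <= 1]: [0] is not coprime to [n], and [1] has [d]-th power [1], so both
   sides are false. *)
rewrite lt_xn andbT andTb; case: ltnP => //; case x_eq : (val x : nat) => [|[|//]] _.
  by move: co_x; rewrite x_eq /coprime gcd0n gtn_eqF.
suff -> : val x = 1 by rewrite expr1n eqxx.
by rewrite -[val x]natr_Zp x_eq.
Qed.

Lemma sum_W (V : nmodType) (n : nat) (f : nat -> V) : (1 < n)%N ->
  \sum_(w in W n) f w = \sum_(x : {unit 'Z_n} | unit_witness x) f (val x).
Proof.
case: n => [|[|n]] // _.
have WE : W n.+2 = [set val x | x : {unit 'Z_n.+2} & unit_witness x]%SET.
  apply/setP => w; rewrite inE; apply/idP/imsetP => [w_wit|[x]]; last first.
    by rewrite inE => xw ->; rewrite mr_witness_unit.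
  have wu : (w : 'Z_n.+2) \is a GRing.unit.
    by rewrite -[w]natr_Zp unitZpE // coprime_sym; case/and4P: w_wit.
  by exists (FinRing.unit 'Z_n.+2 wu); rewrite // inE -mr_witness_unit.
rewrite WE big_imset /=; last by move=> x y _ _; exact: val_inj.
by apply: eq_bigl => x; rewrite inE.
Qed.

(** The sets on the right are disjoint: once [x ^ d] is [1] or some [x ^ (d 2^a)] is [-1], every
    later squaring gives [1], which differs from [-1] as [n > 2]. *)
Lemma sum_unit_witness (V : nmodType) (n : nat) (f : {unit 'Z_n} -> V) : (2 < n)%N ->
  \sum_x f x = \sum_(x | unit_witness x) f x + \sum_(x | val x ^+ mr_d n == 1) f x
    + \sum_(j < mr_s n) \sum_(x | val x ^+ (mr_d n * 2 ^ j) == -1) f x.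
Proof.
move=> n2; set d := mr_d n; have N1 := ZpN1_neq1 n2.
rewrite big_mkcond [X in _ = _ + X + _]big_mkcond [X in _ = X + _ + _]big_mkcond /=.
under [X in _ = _ + X]eq_bigr do rewrite big_mkcond.
rewrite exchange_big -!big_split /=; apply: eq_bigr => x _; rewrite /unit_witness -/d.
have [xd|xd] /= := eqVneq (val x ^+ d) 1.
  rewrite add0r big1 ?addr0 // => j _.
  by rewrite exprM xd expr1n eq_sym (negPf N1).
rewrite addr0; case: ifPn => [/forallP all_j|].
  by rewrite big1 ?addr0 // => j _; rewrite (negPf (all_j j)).
rewrite negb_forall => /existsP[j]; rewrite negbK => xj.
rewrite add0r (bigD1 j) //= xj big1 ?addr0 // => i neq_ij.
case: eqP => // xi; case/negP: neq_ij; apply/eqP/val_inj => /=.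
have lt_absurd (a b : nat) : (a < b)%N ->
    val x ^+ (d * 2 ^ a) = -1 -> val x ^+ (d * 2 ^ b) = -1 -> False.
  move=> /subnKC <- xa; rewrite addSnnS expnD mulnA exprM xa expnS exprM sqrrN !expr1n => e.
  by move/eqP: N1; apply.
case: (ltngtP i j) => // ltij; first by case: (lt_absurd _ _ ltij xi (eqP xj)).
by case: (lt_absurd _ _ ltij (eqP xj) xi).
Qed.

Lemma half_units_witness (n : nat) : odd_composite n ->
  (totient n <= 2 * #|[set x : {unit 'Z_n} | unit_witness x]|)%N.
Proof.
case=> odd_n n1 npr; have [nE odd_d] := mr_decomposition n1.
have s0 : (0 < mr_s n)%N.
  rewrite lt0n; apply/eqP => s0; move: nE; rewrite s0 expn0 muln1 => nE.
  by move: odd_n; rewrite -(prednK (ltnW n1)) /= nE odd_d.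
pose P j := (j < mr_s n)%N && [exists v : {unit 'Z_n}, val v ^+ (mr_d n * 2 ^ j) == -1].
(* The unit [-1] shows that [j = 0] qualifies, because [d] is odd. *)
have P0 : exists j, P j.
  have uN1 : (-1 : 'Z_n) \is a GRing.unit by rewrite unitrN1.
  exists 0%N; rewrite /P s0; apply/existsP; exists (FinRing.unit 'Z_n uN1) => /=.
  by rewrite muln1 -signr_odd odd_d.
have Pub j : P j -> (j <= mr_s n)%N by case/andP => /ltnW.
(* With [j] maximal such that [-1] is a [d 2^j]-th power, all nonwitnesses lie in
   the subgroup [x^(d 2^j) = 1 or -1]. *)
case: (ex_maxnP P0 Pub) => j /andP[lt_js /existsP[v /eqP vE]] maxj.
have dvE : (mr_d n * 2 ^ j %| n.-1)%N.
  by rewrite nE dvdn_pmul2l ?odd_gt0 // dvdn_exp2l // ltnW.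
have [w wB] := power_pm1_proper odd_n n1 npr dvE vE.
have [B BE] := unit_power_pm1_group 'Z_n (mr_d n * 2 ^ j).
have ltB : (2 * #|B| <= #|[set: {unit 'Z_n}]|)%N.
  have /dvdnP[k ek] := cardSg (subsetT B).
  have : (#|B| < #|[set: {unit 'Z_n}]|)%N.
    by apply/proper_card/properP; split; [exact: subsetT|exists w; rewrite ?inE // BE].
  by rewrite ek -{1}[#|B|]mul1n ltn_pmul2r ?cardG_gt0 // leq_pmul2r ?cardG_gt0.
have <- : #|[set: {unit 'Z_n}]| = totient n by exact: card_units_Zp (ltnW n1).
have : (#|[set: {unit 'Z_n}]| <= #|[set x : {unit 'Z_n} | unit_witness x]| + #|B|)%N.
  apply: leq_trans (leq_card_setU _ _); apply/subset_leq_card/subsetP => x _.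
  rewrite !inE BE inE; case: (boolP (unit_witness x)) => //=.
  rewrite /unit_witness negb_and negbK => /orP[/eqP xd|].
    by rewrite exprM xd expr1n eqxx.
  rewrite negb_forall => /existsP[i]; rewrite negbK => xi.
  have : (i <= j)%N by apply: maxj; rewrite /P ltn_ord; apply/existsP; exists x.
  rewrite leq_eqVlt => /orP[/eqP <-|ltij]; first by rewrite xi orbT.
  by rewrite -(subnKC ltij) addSnnS expnD mulnA exprM (eqP xi) expnS exprM sqrrN !expr1n eqxx.
lia.
Qed.

(** The solutions of [x ^ E = u] form the empty set or a coset of the subgroup [x ^ E = 1]. *)
Lemma power_kernel_discrepancy (F : realFieldType) (n m K E : nat) (u : 'Z_n) :
  (1 < n)%N -> (m <= n)%N -> (0 < K)%N -> (K ^ 4 <= n)%N ->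
  (\sum_(x : {unit 'Z_n} | val x ^+ E == u) ((val x < m)%N%:R - m%:R / n%:R)) ^+ 2
    <= 10 * n%:R ^+ 2 / K%:R :> F.
Proof.
move=> n1 mn K0 K4; have [g /eqP gu|no_g] := pickP (fun x : {unit 'Z_n} => val x ^+ E == u).
  have [H HE] := unit_power_group 'Z_n E.
  rewrite (reindex_inj (mulgI g)) /= (eq_bigl (fun h => h \in H)).
    exact: coset_interval_discrepancy.
  move=> h; rewrite HE inE exprMn gu; have uu : u \is a GRing.unit.
    by rewrite -gu unitrX //; exact: valP.
  by rewrite -{2}[u]mulr1 (inj_eq (mulrI uu)).
by rewrite big_pred0 // expr0n /= !mulr_ge0 ?invr_ge0 ?exprn_ge0 ?ler0n.
Qed.

(** * Equidistribution *)

Lemma card_W (n : nat) : (1 < n)%N -> #|W n| = #|[set x : {unit 'Z_n} | unit_witness x]%SET|.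
Proof.
move=> n1; rewrite -!sum1_card (sum_W (fun=> 1%N) n1).
by apply: eq_bigl => x; rewrite inE.
Qed.

Lemma ler_norm_of_sqr (F : realDomainType) (x y : F) : 0 <= y -> x ^+ 2 <= y ^+ 2 -> `|x| <= y.
Proof. by move=> y0; rewrite -real_normK ?num_real // ler_pXn2r ?nnegrE. Qed.

Lemma mr_s_bound (n : nat) : (1 < n)%N -> (2 ^ mr_s n <= n)%N.
Proof.
move=> n1; have [nE odd_d] := mr_decomposition n1.
by rewrite (leq_trans _ (leq_pred n)) // nE leq_pmull // odd_gt0.
Qed.

Lemma W_discrepancy (F : archiRealFieldType) (eps : F) : 0 < eps ->
  exists N, forall n m : nat, (N <= n)%N -> odd_composite n -> (m <= n)%N ->
  `|\sum_(w in W n) ((w < m)%N%:R - m%:R / n%:R)| <= eps * #|W n|%:R :> F.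
Proof.
(* Here [40 = 10 * 4], with [10] from the coset bound and [4] from squaring the [2] in the
   denominator of [e]. *)
move=> eps0; pose c := (Num.bound (40 / eps ^+ 2)).
have c_gt : 40 / eps ^+ 2 < c%:R.
  by apply: archi_boundP; rewrite divr_ge0 ?exprn_ge0 ?ler0n // ltW.
have [N le_N] := mul_poly_log_exp_primes_le c.
exists N => n m Nn oc mn; have [odd_n n1 npr] := oc.
have n2 : (2 < n)%N by move: odd_n n1; case: (n) => [|[|[|]]].
have n0' : 0 < n%:R :> F by rewrite ltr0n ltnW.
set s := mr_s n; pose P := (2 ^ size (primes n))%N.
pose K := (c * (s.+2 * P) ^ 2)%N.
have K4 : (K ^ 4 <= n)%N by apply: le_N => //; exact: mr_s_bound.
have eps20 : 0 < eps ^+ 2 by rewrite exprn_gt0.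
have c0' : 0 < c%:R :> F by apply: lt_trans c_gt; rewrite divr_gt0 ?ltr0n.
have P0' : 0 < P%:R :> F by rewrite ltr0n expn_gt0.
have s0' : 0 < s.+2%:R :> F by rewrite ltr0n.
have K0 : (0 < K)%N by rewrite !(muln_gt0, expn_gt0) -(ltr0n F) c0'.
pose t : F := (totient n)%:R.
have t_gt0 : 0 < t by rewrite ltr0n totient_gt0 ltnW.
have le_t : n%:R <= t * P%:R by rewrite -natrM ler_nat leq_totient_primes // ltnW.
(* The error allowed to each of the [s.+2] solution sets: together they reach [eps * t / 2], and
   [t / 2] is at most [#|W n|]. *)
pose e : F := eps * t / (2 * s.+2%:R).
have e0 : 0 <= e by rewrite divr_ge0 ?mulr_ge0 ?ler0n // ltW.
have le_e : 10 * n%:R ^+ 2 / K%:R <= e ^+ 2.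
  rewrite /K natrM natrX natrM /e.
  have -> : (eps * t / (2 * s.+2%:R)) ^+ 2 = eps ^+ 2 * t ^+ 2 / (4 * s.+2%:R ^+ 2).
    by field; rewrite gt_eqF.
  rewrite ler_pdivrMr ?mulr_gt0 ?exprn_gt0 ?mulr_gt0 //.
  have -> : eps ^+ 2 * t ^+ 2 / (4 * s.+2%:R ^+ 2) * (c%:R * (s.+2%:R * P%:R) ^+ 2) =
      (eps ^+ 2 * c%:R / 4) * (t * P%:R) ^+ 2 by field; rewrite gt_eqF.
  apply: ler_pM; rewrite ?ler0n ?exprn_ge0 ?ler0n //.
    by move: c_gt; rewrite ltr_pdivrMr // mulrC => /ltW; lra.
  by rewrite ler_pXn2r // nnegrE ?ler0n // mulr_ge0 // ltW.
pose f (x : {unit 'Z_n}) : F := (val x < m)%N%:R - m%:R / n%:R.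
have le_pow E u : `|\sum_(x : {unit 'Z_n} | val x ^+ E == u) f x| <= e.
  apply: ler_norm_of_sqr => //; apply: le_trans le_e.
  by apply: power_kernel_discrepancy.
rewrite (sum_W (fun w => (w < m)%N%:R - m%:R / n%:R)) //.
have := sum_unit_witness f n2.
(* The set of all units is the solution set of [x ^ 0 = 1], so [le_pow] covers it as well. *)
have -> : \sum_x f x = \sum_(x | val x ^+ 0 == 1) f x.
  by apply: eq_bigl => x; rewrite expr0 eqxx.
move/eqP; rewrite -subr_eq -subr_eq => /eqP <-.
apply: (@le_trans _ _ (e *+ s.+2)).
  rewrite !mulrSr; apply: le_trans (ler_normB _ _) _; apply: lerD; last exact: le_pow.
  apply: le_trans (ler_normB _ _) _; rewrite addrC; apply: lerD; last exact: le_pow.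
  apply: le_trans (ler_norm_sum _ _ _) _.
  by apply: le_trans (ler_sum _ (fun j _ => le_pow _ _)) _; rewrite sumr_const card_ord.
rewrite -[e *+ _]mulr_natr /e.
have -> : eps * t / (2 * s.+2%:R) * s.+2%:R = eps * (t / 2) by field; rewrite gt_eqF.
rewrite ler_pM2l // ler_pdivrMr ?ltr0n // mulrC -natrM ler_nat card_W //.
exact: half_units_witness.
Qed.

(** Replaces a real endpoint by an integer; the last clause bounds the rounding error. *)
Lemma up_closed_cut (P : pred nat) (n : nat) : P n ->
  (forall i j, (i <= j)%N -> P i -> P j) ->
  exists m : nat, [/\ (m <= n)%N, P =1 leq m & (0 < m)%N -> ~~ P m.-1].
Proof.
move=> Pn Pup; case: (ex_minnP (ex_intro _ n Pn)) => m Pm min_m.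
exists m; split=> [|w|m0]; first exact: min_m.
  by apply/idP/idP => [/min_m//|/Pup]; apply.
by apply/negP => /min_m; rewrite -ltnS prednK // ltnn.
Qed.

Local Open Scope classical_set_scope.

Theorem theorem1 (R : realType) (a b : R) (ha : 0 <= a) (hab : a <= b) (hb : b <= 1) :
  (#|[set w in W n | (a <= (w : nat)%:R / n%:R <= b)%R]%SET|%:R / #|W n|%:R : R)
    @[n --> within odd_composite \oo] --> b - a.
Proof.
apply/cvgrPdist_le => e e0; have e4 : 0 < e / 4 by rewrite divr_gt0.
have [N disc] := W_discrepancy e4.
(* The bound [n >= M] gives [2 / n <= e / 2], which covers the rounding of both endpoints; the two
   discrepancies take [e / 4] each. *)
pose M := Num.bound (4 / e); have M_gt : 4 / e < M%:R.
  by apply: archi_boundP; rewrite divr_ge0 // ltW.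
exists (maxn N M) => // n /= NMn oc; move: NMn; rewrite geq_max => /andP[Nn Mn].
have [odd_n n1 npr] := oc; have n0 : 0 < n%:R :> R by rewrite ltr0n ltnW.
have b0 : 0 <= b by exact: le_trans hab.
have a1 : a <= 1 by exact: le_trans hb.
have [|i j ij|m1 [m1n m1P m1m]] := @up_closed_cut (fun k => a * n%:R <= k%:R) n.
- by rewrite ler_piMl // ltW.
- by move/le_trans; apply; rewrite ler_nat.
(* The inequality is strict because [b] belongs to the interval; the disjunct [n <= k] keeps
   [m2 <= n] even for [b = 1]. *)
have [|i j ij|m2 [m2n m2P m2m]] := @up_closed_cut (fun k => (n <= k)%N || (b * n%:R < k%:R)) n.
- by rewrite leqnn.
- move/orP=> [ni|bi]; apply/orP; [left; exact: leq_trans ij|right].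
  by apply: lt_le_trans bi _; rewrite ler_nat.
have W0 : 0 < #|W n|%:R :> R.
  have t0 : (0 < totient n)%N by rewrite totient_gt0 ltnW.
  by have := leq_trans t0 (half_units_witness oc); rewrite muln_gt0 -card_W // ltr0n.
have m1b : `|m1%:R - a * n%:R| <= 1.
  have := m1P m1; rewrite leqnn /= => am1.
  have : m1%:R - 1 <= a * n%:R.
    case: (m1) m1m => [_|k /(_ isT)]; first by have := mulr_ge0 ha (ltW n0); lra.
    by rewrite /= -ltNge -natr1 addrK => /ltW.
  rewrite ler_norml; move: am1; lra.
have m2b : `|m2%:R - b * n%:R| <= 1.
  have bm2 : b * n%:R <= m2%:R.
    have := m2P m2; rewrite leqnn /= => /orP[nm2|/ltW//].
    by rewrite (eqP (_ : m2 == n)) ?eqn_leq ?m2n // ler_piMl // ltW.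
  have : m2%:R - 1 <= b * n%:R.
    case: (m2) m2m => [_|k /(_ isT)]; first by have := mulr_ge0 b0 (ltW n0); lra.
    by rewrite /= negb_or -leNgt -natr1 addrK => /andP[].
  rewrite ler_norml; move: bm2; lra.
(* The indicator of the interval is that of [w < m2] minus that of [w < m1]; centering both leaves
   the main term [(m2 - m1) / n]. *)
have cntE : #|[set w in W n | (a <= (w : nat)%:R / n%:R <= b)%R]%SET|%:R =
    \sum_(w in W n) ((w < m2)%N%:R - m2%:R / n%:R)
    - \sum_(w in W n) ((w < m1)%N%:R - m1%:R / n%:R)
    + #|W n|%:R * ((m2%:R - m1%:R) / n%:R) :> R.
  have -> : #|W n|%:R * ((m2%:R - m1%:R) / n%:R) =
      \sum_(w in W n) ((m2%:R - m1%:R) / n%:R) :> R by rewrite sumr_const mulr_natl.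
  rewrite -sumrB -big_split /= -sum1_card natr_sum.
  rewrite [RHS]big_mkcond [LHS]big_mkcond; apply: eq_bigr => w _; rewrite inE.
  case: (w \in W n) => //=.
  have -> : (a <= (w : nat)%:R / n%:R) = ~~ (w < m1)%N.
    by rewrite -leqNgt -m1P ler_pdivlMr.
  have -> : ((w : nat)%:R / n%:R <= b) = (w < m2)%N.
    by rewrite ltnNge -m2P negb_or -ltnNge ltn_ord -leNgt ler_pdivrMr.
  have : (w < m1)%N -> (w < m2)%N.
    rewrite !ltnNge -m1P -m2P negb_or -ltnNge ltn_ord /= -leNgt -ltNge => /ltW/le_trans.
    by apply; rewrite ler_pM2r.
  rewrite mulrBl.
  by case: (w < m1)%N => [->//|_]; case: (w < m2)%N => /=; lra.
have := disc n m1 Nn oc m1n; have := disc n m2 Nn oc m2n.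
rewrite cntE; set D1 := \sum_(w in _) (_ - m1%:R / _); set D2 := \sum_(w in _) _.
move=> le2 le1.
have -> : b - a - (D2 - D1 + #|W n|%:R * ((m2%:R - m1%:R) / n%:R)) / #|W n|%:R =
  D1 / #|W n|%:R - D2 / #|W n|%:R + ((m1%:R - a * n%:R) - (m2%:R - b * n%:R)) / n%:R.
  by field; rewrite !gt_eqF.
have normW D : `|D| <= e / 4 * #|W n|%:R -> `|D / #|W n|%:R| <= e / 4.
  by rewrite normrM normfV [`|_%:R|]ger0_norm ?(ltW W0) // ler_pdivrMr.
have inv_n : 2 / n%:R <= e / 2.
  have : 4 / e <= n%:R by rewrite (le_trans (ltW M_gt)) // ler_nat.
  rewrite !ler_pdivrMr //; lra.
have le3 : `|((m1%:R - a * n%:R) - (m2%:R - b * n%:R)) / n%:R| <= e / 2.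
  apply: le_trans inv_n; rewrite normrM normfV [`|n%:R|]ger0_norm ?(ltW n0) //.
  by rewrite ler_pM2r ?invr_gt0 // (le_trans (ler_normB _ _)) //; lra.
apply: le_trans (ler_normD _ _) _.
have := ler_normB (D1 / #|W n|%:R) (D2 / #|W n|%:R).
by have := normW _ le1; have := normW _ le2; lra.
Qed.
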